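(* Let $1\le n<N$ be integers and let $y\in C_n^N$. Let $X(0)$ be random with distribution $M(y,\cdot)$, let $(X(k),k\ge 0)$ be a Markov chain on $C_n^N$ with initial state $X(0)$ and transition matrix $Q$, and let $(Y(k),k\ge 0)$ be the process in $C_n^N$ with $Y(0)=y$ constructed from $y$ and $(X(k),k\ge 0)$ by the deterministic update rule described in the context (so that $X(k)\preceq Y(k)$ for all $k$). Then $(Y(k),k\ge 0)$ is a Markov chain started at $y$ with transition matrix $Q$. Moreover, for each integer $T>0$, the conditional law of $X(T)$, given $(Y(k),\ T\ge k\ge 0)$, is $M(Y(T),\cdot)$.
   Context: The discrete circle has $N$ positions labelled $0,1,\ldots,N-1$ in the anti-clockwise direction. $C_n^N$ is the set of configurations of $n$ indistinguishable particles at distinct positions of the discrete circle. For a configuration $x$ with particles at $k_1,\ldots,k_n$, set $\Delta(x)=\prod_{1\le i<j\le n}|e^{2\pi \sqrt{-1}\,k_j/N}-e^{2\pi \sqrt{-1}\,k_i/N}|$. Write $x\nearrow y$ if $y\in C_n^N$ can be obtained from $x\in C_n^N$ by moving one particle one step anti-clockwise (to a vacant position). Write $x\preceq y$ ($x$ and $y$ are interlaced) if the particles can be labelled so that $x$ has particles at positions $k_1,\ldots,k_n\in\{0,\dots,N-1\}$, $y$ has particles at positions $l_1,\ldots,l_n\in\{0,\dots,N-1\}$, $k_j<l_j\le k_{j+1}$ for $j<n$, and either $k_n<l_n\le k_1+N$ or $k_n<l_n+N\le k_1+N$. It is a fact that $\Delta$ is a positive eigenvector of the matrix $1_{x\nearrow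 y}$, i.e. $\sum_{y:\,x\nearrow y}\Delta(y)=\lambda\Delta(x)$ for some $\lambda>0$, and that $\sum_{x:\,x\preceq y}\Delta(x)=\gamma\Delta(y)$ for some $\gamma>0$. The Markov kernels $Q$ and $M$ on $C_n^N$ are $$Q(x,y)=\frac1\lambda\frac{\Delta(y)}{\Delta(x)}1_{x\nearrow y},\qquad M(y,x)=\frac1\gamma\frac{\Delta(x)}{\Delta(y)}1_{x\preceq y}.$$ Update rule: for each $k\ge 0$, given $X(k)\preceq Y(k)$ and $X(k+1)$ with $X(k)\nearrow X(k+1)$, the configuration $Y(k+1)$ is obtained from $Y(k)$ by moving exactly one particle one step anti-clockwise. If the particle that moves in the transition $X(k)\to X(k+1)$ moves from position $p$ to position $p+1$ (mod $N$), then the particle of $Y(k)$ that moves is the first one encountered when examining positions in anti-clockwise order $p+1,p+2,\ldots$ (mod $N$, ending at $p$) which can be moved one step anti-clockwise without breaking the interlacing constraint, i.e. such that the resulting configuration $Y(k+1)$ satisfies $X(k+1)\preceq Y(k+1)$. Such a particle always exists. *)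

(* Defs.v *)
From HB Require Import structures.
From mathcomp Require Import all_boot all_order all_algebra.
From mathcomp Require Import all_classical all_reals all_analysis.
From mathcomp Require Import complex.

Set Implicit Arguments.
Unset Strict Implicit.
Unset Printing Implicit Defensive.

Import Order.TTheory GRing.Theory Num.Theory.

Local Open Scope classical_set_scope.
Local Open Scope ring_scope.

(** ** Configurations on the discrete circle *)

(* The positions are the elements of 'I_N, and the anti-clockwise neighbour of
   p is [ordS p], that is, p + 1 mod N. *)
Notation config n N := {x : {set 'I_N} | #|x| == n}.

Section Circle.
Context {n N : nat}.
Implicit Types (x y : config n N) (p q : 'I_N).

Definition moves x p y : bool :=
  [&& p \in val x, ordS p \notin val x
    & val y == ordS p |: (val x :\ p)]%SET.

(* x ↗ y *)
Definition arrow x y : bool := [exists p, moves x p y].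

(* x ≼ y.  The labels 1, ..., n are here 0, ..., n - 1, so that in the last
   conjunct j plays the role of n and i that of 1. *)
Definition interlaced x y : bool :=
  [exists k : {ffun 'I_n -> 'I_N}, [exists l : {ffun 'I_n -> 'I_N},
    [&& val x == [set k j | j : 'I_n]%SET,
        val y == [set l j | j : 'I_n]%SET,
        [forall i : 'I_n, forall j : 'I_n,
           (j == i.+1 :> nat) ==> (k i < l i <= k j)%N]
      & [forall i : 'I_n, forall j : 'I_n,
           ((i == 0%N :> nat) && (j.+1 == n)) ==>
             ((k j < l j <= k i + N) || (k j < l j + N <= k i + N))%N]]]].

(* The configuration obtained from y by moving the particle at q, provided that
   this is possible and that the result z satisfies x' ≼ z. *)
Definition push x' y q : option (config n N) :=
  [pick z | moves y q z && interlaced x' z].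

(* One step of the update rule: if p is the position such that x' is obtained
   from x by moving the particle at p to p + 1, the positions p + 1, p + 2, ...,
   p + N = p mod N are examined in this order, and y is replaced by the result
   of the first successful push.  The value y is only a default, for arguments
   that the rule does not cover. *)
Definition update x x' y : config n N :=
  if [pick p | moves x p x'] is Some p
  then head y (pmap (push x' y) (traject (@ordS N) (ordS p) N))
  else y.

Fixpoint driven {T : Type} (y : config n N) (X : nat -> T -> config n N)
    (k : nat) (w : T) : config n N :=
  if k is k'.+1 then update (X k' w) (X k w) (driven y X k' w) else y.

End Circle.

(** ** The function Δ and the kernels Q and M *)

Section Kernels.
Context {R : realType} {n N : nat}.
Implicit Types x y : config n N.

(* exp (2 π √-1 k / N) *)
Definition circle_point (k : 'I_N) : R[i] :=
  let t : R := 2 * pi * k%:R / N%:R in (cos t +i* sin t)%C.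

Definition Delta x : R :=
  \prod_(i in val x) \prod_(j in val x | (i < j)%N)
    ComplexField.Normc.normc (circle_point j - circle_point i).

Definition lambda_spec (l : R) : Prop :=
  0 < l /\
  forall x : config n N, \sum_(y : config n N | arrow x y) Delta y = l * Delta x.

Definition gamma_spec (g : R) : Prop :=
  0 < g /\
  forall y : config n N,
    \sum_(x : config n N | interlaced x y) Delta x = g * Delta y.

(* The numbers λ and γ that satisfy the specifications above: they exist, and
   are unique, when 1 <= n < N. *)
Definition lambda : R := xget 0 [set l : R | lambda_spec l].
Definition gamma : R := xget 0 [set g : R | gamma_spec g].

Definition Q x y : R := lambda^-1 * (Delta y / Delta x) * (arrow x y)%:R.

Definition M y x : R := gamma^-1 * (Delta x / Delta y) * (interlaced x y)%:R.

End Kernels.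

Arguments lambda_spec {R} n N l.
Arguments gamma_spec {R} n N g.
Arguments lambda {R} n N.
Arguments gamma {R} n N.

(** ** Markov chains with values in a finite type *)

Section Markov.
Context {d : measure_display} {Omega : measurableType d} {R : realType}.
Variable P : probability Omega R.
Context {S : finType}.
Implicit Types (Z : nat -> Omega -> S) (s : nat -> S).

(* Conditional probability of A given B, meaningful when P B > 0. *)
Definition cond_prob (A B : set Omega) : R := fine (P (A `&` B)) / fine (P B).

(* The event that Z(0) = s(0), ..., Z(k) = s(k). *)
Definition history Z (k : nat) s : set Omega :=
  [set w | forall i, (i <= k)%N -> Z i w = s i].

(* Z is a Markov chain with initial law mu and transition matrix K, with respect
   to the discrete σ-algebra on the finite state space S. *)
Definition markov_chain (mu : S -> R) (K : S -> S -> R) Z : Prop :=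
  [/\ forall k a, measurable (Z k @^-1` [set a]),
      forall a, fine (P (Z 0%N @^-1` [set a])) = mu a
    & forall k s a, (0 < P (history Z k s))%E ->
        cond_prob (Z k.+1 @^-1` [set a]) (history Z k s) = K (s k) a].

End Markov.

(* Main.v *)
Require Import Defs.
From HB Require Import structures.
From mathcomp Require Import all_boot all_order all_algebra.
From mathcomp Require Import all_classical all_reals all_analysis.
From mathcomp Require Import complex ring lra zify.

Set Implicit Arguments.
Unset Strict Implicit.
Unset Printing Implicit Defensive.

Import Order.TTheory GRing.Theory Num.Theory.

(** The kernels are intertwined through the coupling: for all y, y' and x',

      sum over x with update x x' y = y' of M(y,x) Q(x,x') = Q(y,y') M(y',x').

    Since M(y,x) Q(x,x') and Q(y,y') M(y',x') both equal Δ(x')/(γ λ Δ(y)) on their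
    supports, this says that x ↦ update x x' y is a bijection from
    {x : x ≼ y, x ↗ x'} onto {y' : y ↗ y', x' ≼ y'}.  By induction on k the
    intertwining gives
    P(Y(0..k) = s, X(k) = x) = P(Y(0..k) = s) M(s(k), x), from which both claims
    follow.  No eigenvector property of Δ is needed: the law of X(0) has mass 1, which
    forces γ ≠ 0, hence the existence of γ; and 1/λ is a common factor of both sides.

    For the bijection, x ≼ y holds iff the circle carries a 0/1-valued height h,
    the indicator of the arcs that lead from each particle of x to the next
    particle of y, that increases by one at the particles of x and decreases by one
    at those of y.  When x' and y are at one step from being interlaced, they have
    a height h that vanishes somewhere, and h is unique.  Moving x' one step back to
    p (resp. y one step ahead from q) gives an interlaced pair iff h can be raised
    at p (resp. at q).  If x' ≼ y, the possible p are the right ends of the arcs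
    where h = 0, the possible q are their left ends, and the two alternate around
    the circle; otherwise there is a single site where interlacing fails, and it
    is the only possible p + 1 and the only possible q. *)

(** * Heights on the circle and ranks counted from position 0 *)

Section Cyclic.
Variable N : nat.
Implicit Types (A B : {set 'I_N}) (h : 'I_N -> bool) (p q r : 'I_N).

Lemma ordS_val p : ordS p = (if p.+1 == N then 0 else p.+1) :> nat.
Proof.
rewrite /=; case: eqP => [->|/eqP ne]; first by rewrite modnn.
by rewrite modn_small // ltn_neqAle ne /=.
Qed.

Lemma ordS_neq p : (1 < N)%N -> ordS p != p.
Proof.
by move=> N1; apply: contra_eq_neq (ordS_val p) => ->; case: (p.+1 =P N); lia.
Qed.

(* [h p] is the height between the sites [p] and [ordS p]; within a site, the
   particle of B is met before that of A. *)
Definition separates h A B : Prop := forall p,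
  [/\ p \in A -> h p, ordS p \in B -> h p
    & (h (ordS p) + (ordS p \in B) = h p + (ordS p \in A))%N].

Definition below A m := #|[set r in A | (r < m)%N]|.

Lemma below0 A : below A 0 = 0%N.
Proof. by apply: eq_card0 => r; rewrite inE ltn0 andbF. Qed.

Lemma belowS A p : below A p.+1 = (below A p + (p \in A))%N.
Proof.
rewrite /below (cardD1 p) inE ltnSn andbT addnC; congr (_ + _)%N.
by apply: eq_card => r; rewrite !inE ltnS ltn_neqAle -val_eqE /=; case: eqP; case: (r \in A).
Qed.

Lemma belowN A : below A N = #|A|.
Proof. by apply: eq_card => r; rewrite inE ltn_ord andbT. Qed.

Lemma below_mono A m m' : (m <= m')%N -> (below A m <= below A m')%N.
Proof.
move=> mm'; apply/subset_leq_card/fintype.subsetP => r; rewrite !inE => /andP[-> /=].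
by move/leq_trans; apply.
Qed.

Lemma ltn_below A p m : p \in A -> (p < m)%N = (below A p < below A m)%N.
Proof.
move=> pA; case: (ltnP p m) => [pm|mp].
  by apply/esym; apply: leq_trans (below_mono A pm); rewrite belowS pA addn1.
by apply/esym/negbTE; rewrite -leqNgt below_mono.
Qed.

Lemma below_surj A j : (j < #|A|)%N -> exists2 p, p \in A & below A p = j.
Proof.
move=> jA; have ex : exists m, (j < below A m)%N by exists N; rewrite belowN.
case: (ex_minnP ex) => -[|m] jm mmin; first by rewrite below0 in jm.
have mN : (m < N)%N by apply: mmin; rewrite belowN.
have := belowS A (Ordinal mN) => /= e.
have : (below A m <= j)%N by rewrite leqNgt; apply/negP => /mmin; rewrite ltnn.
move: jm; rewrite e; case mA: (_ \in A) => jm jm'; last by lia.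
by exists (Ordinal mN) => //=; lia.
Qed.

(** On [A], the rank [below A] is a bijection onto the integers below [n], so particles can be
    labelled with any prescribed ranks. The freedom in [g] serves for the cyclic shift of labels in
    [separates_interlaced]. *)
Lemma rank_label n A (g : 'I_n -> nat) :
    #|A| = n -> injective g -> (forall j, g j < n)%N ->
  exists2 k : {ffun 'I_n -> 'I_N}, A = [set k j | j : 'I_n]%SET
    & forall j, (k j \in A) /\ below A (k j) = g j.
Proof.
move=> cA ginj gn.
have /fin_all_exists [k kP] : forall j, exists p, p \in A /\ below A p = g j.
  by move=> j; have [|p pA e] := @below_surj A (g j); [rewrite cA | exists p].
exists (finfun k); last by move=> j; rewrite ffunE.
have kinj : injective (finfun k).
  by move=> i j; rewrite !ffunE => e; apply/ginj; rewrite -(kP i).2 e (kP j).2.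
apply/esym/eqP; rewrite eqEcard card_imset // card_ord cA leqnn andbT.
by apply/fintype.subsetP => _ /imsetP[j _ ->]; rewrite ffunE; case: (kP j).
Qed.

(** The height equation telescopes from the origin [z] to [p]; the height just before [z] is the
    constant of integration. *)
Lemma separates_below h A B (z p : 'I_N) : z = 0%N :> nat -> separates h A B ->
  (h (ord_pred z) + below A p.+1 = h p + below B p.+1)%N.
Proof.
move=> z0 hs; have [m mp] : exists m, m = p :> nat by exists p.
elim: m p mp => [|m IH] p mp.
  have -> : p = z by apply/val_inj; rewrite /= -mp.
  have [_ _] := hs (ord_pred z); rewrite ord_predK !belowS.
  by rewrite z0 !below0 !add0n => ->.
have mN : (m < N)%N by rewrite (leq_trans _ (ltnW (ltn_ord p))) // -mp.
have /= := IH (Ordinal mN) erefl; have [_ _] := hs (Ordinal mN).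
have -> : ordS (Ordinal mN) = p by apply/val_inj; rewrite /= modn_small // mp.
rewrite !belowS -mp.
by move: (h p) (h (Ordinal mN)) (h (ord_pred z)) (p \in A) (p \in B) => *; lia.
Qed.
End Cyclic.

(** * Interlacing as the existence of a separating height *)

Section Interlacing.
Variables n N : nat.
Hypothesis n_gt0 : (0 < n)%N.
Implicit Types (x y : config n N).

Lemma separates_interlaced x y h : separates h (val x) (val y) -> interlaced x y.
Proof.
move=> hs; have cx := eqP (valP x); have cy := eqP (valP y).
have N_gt0 : (0 < N)%N.
  by have := max_card (val x); rewrite card_ord cx; apply: leq_trans.
have [k xE kP] := rank_label cx (@ord_inj n) (@ltn_ord n).
(* [w] tells whether an arc crosses from N-1 to 0. If so, the particle of [y] of rank 0 ends the arc
   of the last particle of [x], hence the cyclic shift of ranks in [g]. *)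
pose w : bool := h (ord_pred (Ordinal N_gt0)).
have top (p : 'I_N) : (w + below (val x) p.+1 = h p + below (val y) p.+1)%N.
  exact: separates_below.
pose g (j : 'I_n) := (if w then if j.+1 == n then 0 else j.+1 else j)%N.
have gn j : (g j < n)%N by rewrite /g; case: (w) => //; case: eqP; have := ltn_ord j; lia.
have ginj : injective g.
  move=> i j; rewrite /g => e; apply: val_inj => /=; move: e (ltn_ord i) (ltn_ord j).
  by case: (w) => //; case: eqP; case: eqP; lia.
have [l yE lP] := @rank_label _ _ _ g cy ginj gn.
have kl i m : (k i < m)%N = (i < below (val x) m)%N.
  by rewrite (ltn_below _ (kP i).1) (kP i).2.
have ll i m : (l i < m)%N = (g i < below (val y) m)%N.
  by rewrite (ltn_below _ (lP i).1) (lP i).2.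
(* Through [kl] and [ll], the counts [hl] and [hk] turn the required inequalities between positions
   into comparisons of ranks. *)
have hl i : (below (val x) (l i) + w = (g i).+1)%N.
  have := top (l i); have [_ hy] := hs (ord_pred (l i)); move: hy; rewrite ord_predK !belowS.
  rewrite (lP i).1 (lP i).2 => -> //.
  by move: (h (l i)) (l i \in val x) => *; lia.
have hk i : (below (val y) (k i).+1 + 1 = w + i.+1)%N.
  have := top (k i); have [hx _ _] := hs (k i); rewrite belowS.
  by rewrite hx ?(kP i).1 ?(kP i).2 //; clear; lia.
apply/existsP; exists k; apply/existsP; exists l; apply/and4P; split.
- exact/eqP.
- exact/eqP.
- apply/forallP => i; apply/forallP => j; apply/implyP => /eqP ji.
  rewrite kl -[(l i <= k j)%N]ltnS ll.
  have := hl i; have := hk j; have := ltn_ord j; rewrite /g.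
  by case: (w); case: (i.+1 =P n); lia.
- apply/forallP => i; apply/forallP => j; apply/implyP => /andP[/eqP i0 /eqP jn].
  have := hl j; have := hk i; have := kl j (l j); have := ll j (k i).+1.
  have := ltn_ord (l j); have := ltn_ord (k j); rewrite /g jn eqxx.
  by case: (w); lia.
Qed.

(** The height is the indicator of the union of the cyclic intervals from k_j (included) to l_j
    (excluded). Interlacing makes these disjoint, and the equation then holds site by site. *)
Lemma interlaced_separates x y :
  interlaced x y -> exists h, separates h (val x) (val y).
Proof.
move=> xy; have [k [l [xE yE H1 H2]]] : exists k l : 'I_n -> 'I_N,
    [/\ val x = [set k j | j : 'I_n]%SET, val y = [set l j | j : 'I_n]%SET,
      forall i j : 'I_n, j = i.+1 :> nat -> (k i < l i <= k j)%N
    & forall i j : 'I_n, i = 0%N :> nat -> j.+1 = n ->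
        (k j < l j)%N || (l j <= k i)%N].
  case/existsP: xy => k /existsP[l /and4P[/eqP xE /eqP yE /forallP H1 /forallP H2]].
  exists k, l; split=> // i j.
    by move=> ji; have /forallP/(_ j)/implyP := H1 i; apply; apply/eqP.
  move=> i0 jn; have /forallP/(_ j)/implyP := H2 i; rewrite i0 jn !eqxx /=.
  by move/(_ isT); lia.
have step (i j : 'I_n) : (i < j)%N -> (k i < l i <= k j)%N.
  have [m mj] : exists m, m = j - i.+1 by eexists.
  elim: m i j mj => [|m IH] i j mj ij; first by apply: H1; lia.
  have jn : (j.-1 < n)%N by have := ltn_ord j; lia.
  have /IH : m = Ordinal jn - i.+1 by move=> /=; lia.
  have := H1 (Ordinal jn) j; rewrite /=; lia.
(* Only the last arc can wrap past 0, and it then ends no later than any other arc begins. *)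
have sep (i j : 'I_n) : (i < j)%N -> (k j < l j)%N || (l j <= k i)%N.
  move=> ij; have := ltn_ord j; rewrite leq_eqVlt => /orP[/eqP jn|jn].
    have := H2 (Ordinal n_gt0) j erefl jn; case: (posnP i) => i0.
      by rewrite (_ : Ordinal _ = i) //; apply: val_inj; rewrite /= i0.
    by have := step (Ordinal n_gt0) i i0; lia.
  by have := H1 j (Ordinal jn) erefl; lia.
pose arc j p := if (k j < l j)%N then (k j <= p < l j)%N else (k j <= p)%N || (p < l j)%N.
pose h (p : 'I_N) := [exists j, arc j p].
have hx p : p \in val x -> h p.
  rewrite xE => /imsetP[j _ ->]; apply/existsP; exists j; rewrite /arc.
  by case: ifP => [->|]; rewrite leqnn.
have hy p : ordS p \in val y -> h p.
  rewrite yE => /imsetP[j _ e]; apply/existsP; exists j; rewrite /arc .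
  have := ordS_val p; rewrite e.
  by have := ltn_ord p; have := ltn_ord (k j);
    case: (ltnP (k j) (l j)) => ?; case: (p.+1 =P N); lia.
(* Disjointness of the arcs enters in [hxy] and [hyx]; [hS] and [hP] express that arcs begin and end
   only at particles. *)
have hxy p : ordS p \in val y -> h (ordS p) -> ordS p \in val x.
  rewrite yE => /imsetP[i _ e] /existsP[j].
  rewrite xE e => a; apply/imsetP; exists j => //; apply: val_inj => /=.
  move: a; rewrite /arc; case: (ssrnat.ltngtP i j) => [ij|ij|/val_inj ij].
  - by have := step _ _ ij; have := sep _ _ ij; case: (ltnP (k j) (l j)); lia.
  - by have := step _ _ ij; have := sep _ _ ij; case: (ltnP (k j) (l j)); lia.
  - by rewrite ij; case: (ltnP (k j) (l j)); lia.
have hyx p : ordS p \in val x -> h p -> ordS p \in val y.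
  rewrite xE => /imsetP[i _ e] /existsP[j].
  rewrite yE e => a; apply/imsetP; exists j => //; apply: val_inj => /=.
  have := ordS_val p; rewrite e.
  have := ltn_ord p; have := ltn_ord (k j); have := ltn_ord (l j); move: a; rewrite /arc.
  case: (ssrnat.ltngtP i j) => [ij|ij|/val_inj ij].
  - by have := step _ _ ij; have := sep _ _ ij;
      case: (ltnP (k j) (l j)) => ?; case: (p.+1 =P N); lia.
  - by have := step _ _ ij; have := sep _ _ ij;
      case: (ltnP (k j) (l j)) => ?; case: (p.+1 =P N); lia.
  - by rewrite ij; case: (ltnP (k j) (l j)) => ?; case: (p.+1 =P N); lia.
have hS p : h (ordS p) -> ordS p \notin val x -> h p.
  move=> /existsP[j a] /negP sx; apply/existsP; exists j; move: a.
  have ne : (k j != ordS p :> nat).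
    by apply: contra_not_neq sx => /val_inj <-; rewrite xE imset_f.
  move: ne; rewrite /arc ordS_val; have := ltn_ord p; have := ltn_ord (l j).
  by have := ltn_ord (k j); case: (ltnP (k j) (l j)) => ?; case: (p.+1 =P N); lia.
have hP p : h p -> ordS p \notin val y -> h (ordS p).
  move=> /existsP[j a] /negP sy; apply/existsP; exists j; move: a.
  have ne : (l j != ordS p :> nat).
    by apply: contra_not_neq sy => /val_inj <-; rewrite yE imset_f.
  move: ne; rewrite /arc ordS_val; have := ltn_ord p; have := ltn_ord (l j).
  by have := ltn_ord (k j); case: (ltnP (k j) (l j)) => ?; case: (p.+1 =P N); lia.
exists h => p; split; [exact: hx | exact: hy |].
move: (hx (ordS p)) (hy p) (hxy p) (hyx p) (hS p) (hP p).
case: (h p); case: (h (ordS p)); case: (_ \in val x); case: (_ \in val y) => //=;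
  by do ?[move/(_ isT)]; intuition.
Qed.
End Interlacing.

(** Links the form used in [update], the head of the successful results, to the form used in
    [first_in], the first index of success. *)
Lemma head_pmap (T U : Type) (f : T -> option U) (a : pred T) (x0 : T) (y : U) s :
  (forall r, isSome (f r) = a r) -> has a s ->
  f (nth x0 s (find a s)) = Some (head y (pmap f s)).
Proof.
move=> fa; elim: s => //= r s IH; rewrite -fa.
by case E: (f r) => //= /IH.
Qed.

(** * Normalised heights, and the matching of sources with targets *)

Section Height.
Variable N : nat.
Implicit Types (A B : {set 'I_N}) (h : 'I_N -> bool) (p q r : 'I_N).

Lemma iter_ordS m p : iter m (@ordS N) p = (p + m) %% N :> nat.
Proof.
elim: m => [|m IH] /=; first by rewrite addn0 modn_small.
by rewrite IH -addn1 modnDml addn1 addnS.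
Qed.

Lemma iter_ordS_connect p q : exists m, q = iter m (@ordS N) p.
Proof.
exists (q + N - p); apply: val_inj; rewrite /= iter_ordS.
by rewrite subnKC ?modnDr ?modn_small // ltnW // ltn_addl.
Qed.

Lemma iter_ordSN p : iter N (@ordS N) p = p.
Proof. by apply: val_inj; rewrite /= iter_ordS modnDr modn_small. Qed.

(** The equation determines a height up to an additive constant; the zero fixes the constant. *)
Definition height h A B : Prop := (exists r, ~~ h r) /\
  forall p, (h (ordS p) + (ordS p \in B) = h p + (ordS p \in A))%N.

(** The difference of [h1] and [h2] is constant around the circle; it is at most 0 at a zero of [h1]
    and at least 0 at a zero of [h2]. *)
Lemma height_unique A B h1 h2 : height h1 A B -> height h2 A B -> h1 =1 h2.
Proof.
move=> [[r1 r1P] H1] [[r2 r2P] H2] r.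
have const m : (h1 (iter m (@ordS N) r) + h2 r = h1 r + h2 (iter m (@ordS N) r))%N.
  elim: m => // m; move: (H1 (iter m (@ordS N) r)) (H2 (iter m (@ordS N) r)); rewrite !iterS.
  move: (h1 (ordS _)) (h2 (ordS _)) (h1 (iter _ _ _)) (h2 (iter _ _ _)) (h1 r) (h2 r).
  by move: (_ \in B) (_ \in A) => *; lia.
have [m1 e1] := iter_ordS_connect r r1; have [m2 e2] := iter_ordS_connect r r2.
move: (const m1) (const m2); rewrite -e1 -e2 (negbTE r1P) (negbTE r2P).
by case: (h1 r) (h2 r) => -[] //=; case: (h2 r1); case: (h1 r2).
Qed.

(* Given the height equation, interlacing can fail at the site [ordS p] only in this way. *)
Definition blocked h A B p :=
  [&& ordS p \in A, ordS p \in B, ~~ h p & ~~ h (ordS p)].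

(* The particle of A moved back to [p], resp. the particle of B moved forward from
   [ordS p] (not from [p]): see [sourcesP] and [targetsP]. *)
Definition sources h A B :=
  [set p | [&& ~~ h p, ordS p \in A & [forall r, blocked h A B r ==> (r == p)]]].

Definition targets h A B :=
  [set p | [&& ~~ h (ordS p), ordS p \in B & [forall r, blocked h A B r ==> (r == p)]]].

Lemma unblocked h A B p : height h A B -> ~~ blocked h A B p ->
  (ordS p \in A -> h (ordS p)) /\ (ordS p \in B -> h p).
Proof.
case=> _ /(_ p); rewrite /blocked; case: (h p); case: (h (ordS p)) => //=;
  by case: (_ \in A); case: (_ \in B).
Qed.

Lemma eq_sources h1 h2 A B : h1 =1 h2 -> sources h1 A B = sources h2 A B.
Proof.
move=> e; apply/setP => p; rewrite !inE e; congr [&& _, _ & _].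
by apply: eq_forallb => r; rewrite /blocked !e.
Qed.

Lemma eq_targets h1 h2 A B : h1 =1 h2 -> targets h1 A B = targets h2 A B.
Proof.
move=> e; apply/setP => p; rewrite !inE e; congr [&& _, _ & _].
by apply: eq_forallb => r; rewrite /blocked !e.
Qed.

(** A blocked [v] is the only candidate for both sets, and it passes both tests unless a second
    blocked site excludes it from both. *)
Lemma sources_blocked h A B v : blocked h A B v -> sources h A B = targets h A B.
Proof.
move=> bv; apply/setP => p; rewrite !inE.
case: forallP => [/(_ v)/implyP/(_ bv)/eqP <-|_]; last by rewrite !andbF.
by have /and4P[-> -> -> ->] := bv.
Qed.

Lemma sourcesE h A B : height h A B -> (forall r, ~~ blocked h A B r) ->
  sources h A B = [set p | ~~ h p & h (ordS p)].
Proof.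
move=> hh nb; apply/setP => p; rewrite !inE.
have -> : [forall r, blocked h A B r ==> (r == p)].
  by apply/forallP => r; rewrite (negbTE (nb r)).
have := nb p; have [_ /(_ p)] := hh; rewrite /blocked.
by case: (h p); case: (h (ordS p)) => //=; case: (_ \in A); case: (_ \in B).
Qed.

Lemma targetsE h A B : height h A B -> (forall r, ~~ blocked h A B r) ->
  targets h A B = [set p | h p & ~~ h (ordS p)].
Proof.
move=> hh nb; apply/setP => p; rewrite !inE.
have -> : [forall r, blocked h A B r ==> (r == p)].
  by apply/forallP => r; rewrite (negbTE (nb r)).
have := nb p; have [_ /(_ p)] := hh; rewrite /blocked.
by case: (h p); case: (h (ordS p)) => //=; case: (_ \in A); case: (_ \in B).
Qed.

(** Around a circle [h] rises as often as it falls: [H] and its shift have the same cardinality,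
    hence so do their two differences. *)
Lemma card_sources h A B : height h A B -> #|sources h A B| = #|targets h A B|.
Proof.
move=> hh; case: (pickP (blocked h A B)) => [v /sources_blocked -> //|nb].
have {}nb r : ~~ blocked h A B r by rewrite nb.
rewrite sourcesE // targetsE //; pose H := [set p | h p].
have -> : [set p | ~~ h p & h (ordS p)] = ((@ordS N) @^-1: H :\: H).
  by apply/setP => p; rewrite !inE.
have -> : [set p | h p & ~~ h (ordS p)] = (H :\: (@ordS N) @^-1: H).
  by apply/setP => p; rewrite !inE andbC.
rewrite !cardsD finset.setIC card_preimset //; exact: ordS_inj.
Qed.

(** The search starts at [p] itself, whereas [update] starts at [ordS p], because a target [r]
    stands for the particle at [ordS r]. *)
Definition first_in (T : {set 'I_N}) p :=
  let s := traject (@ordS N) p N in nth p s (find (mem T) s).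

Lemma first_inP (T : {set 'I_N}) p m : (m < N)%N -> iter m (@ordS N) p \in T ->
  exists2 m', (m' < N)%N & [/\ first_in T p = iter m' (@ordS N) p,
    iter m' (@ordS N) p \in T & forall j, (j < m')%N -> iter j (@ordS N) p \notin T].
Proof.
move=> mN mT; pose s := traject (@ordS N) p N.
have hs : has (mem T) s.
  by apply/hasP; exists (iter m (@ordS N) p) => //; apply/trajectP; exists m.
have fN : (find (mem T) s < N)%N by have := hs; rewrite has_find size_traject.
exists (find (mem T) s) => //; have := nth_find p hs.
rewrite /first_in -/s nth_traject // => fT.
split=> // j jf; have := before_find p jf.
by rewrite nth_traject ?(ltn_trans jf) //= => ->.
Qed.

Lemma source_target h A B p : height h A B -> p \in sources h A B ->
  exists2 m, (m < N)%N & iter m (@ordS N) p \in targets h A B.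
Proof.
move=> hh; case: (pickP (blocked h A B)) => [v bv|nb].
  by rewrite (sources_blocked bv) => pT; exists 0 => //; apply: leq_ltn_trans (ltn_ord p).
have {}nb r : ~~ blocked h A B r by rewrite nb.
rewrite sourcesE // targetsE // inE => /andP[hp hSp].
have N1 : (0 < N.-1)%N.
  case: (posnP N.-1) => // N0; have := iter_ordSN p.
  have NE : N = 1 by have := ltn_ord p; lia.
  by rewrite [X in iter X]NE /= => e; rewrite -e hSp in hp.
(* After [N] steps the walk is back at [p], where [h] vanishes, so [N.-1] is a witness; the least
   one is the first fall after the rise at [p]. *)
pose D m := (0 < m)%N && ~~ h (iter m.+1 (@ordS N) p).
have Nex : D N.-1.
  by rewrite /D N1 prednK ?iter_ordSN //; lia.
have [m /andP[m0 mP] mmin] := ex_minnP (ex_intro D _ Nex); exists m.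
  by have := mmin _ Nex; lia.
rewrite !inE -iterS mP andbT; case: m m0 mP mmin => // -[|m] _ mP mmin //.
by apply: contraT => /= hm; have := mmin m.+1; rewrite /D /= hm ltnn => /(_ isT).
Qed.

Lemma first_in_target h A B p : height h A B -> p \in sources h A B ->
  first_in (targets h A B) p \in targets h A B.
Proof.
by move=> hh /(source_target hh)[m mN mT]; have [m' _ [-> ]] := first_inP mN mT.
Qed.

(** If two sources reach the same target, the nearer one lies on the way from the farther one.
    Strictly after a source and up to its first target [h] stays 1, whereas [h] vanishes at a
    source, so the two coincide. *)
Lemma first_in_inj h A B : height h A B ->
  {in sources h A B &, injective (first_in (targets h A B))}.
Proof.
move=> hh p1 p2 p1S p2S.
have [m1 m1N m1T] := source_target hh p1S; have [m2 m2N m2T] := source_target hh p2S.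
have [k1 _ [-> k1T k1min]] := first_inP m1N m1T.
have [k2 _ [-> k2T k2min]] := first_inP m2N m2T.
case: (pickP (blocked h A B)) => [v bv|nb].
  have k0 p k : p \in sources h A B ->
      (forall j, (j < k)%N -> iter j (@ordS N) p \notin targets h A B) -> k = 0.
    by rewrite (sources_blocked bv) => pT; case: k => // k /(_ 0 isT); rewrite /= pT.
  by rewrite (k0 _ _ p1S k1min) (k0 _ _ p2S k2min).
have {}nb r : ~~ blocked h A B r by rewrite nb.
move: p1S p2S k1min k2min; rewrite sourcesE // targetsE // !inE.
wlog le12 : p1 p2 k1 k2 {m1 m2 m1N m2N m1T m2T k1T k2T} / (k1 <= k2)%N.
  move=> W p1S p2S k1min k2min e.
  case: (leqP k1 k2) => [/W|/ltnW/W]; first exact.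
  by move=> V; apply/esym/V.
move=> /andP[hp1 _] /andP[_ hp2] _ k2min e.
have up j : (j < k2)%N -> h (iter j.+1 (@ordS N) p2).
  elim: j => // j IH jk; have := k2min j.+1 jk.
  by rewrite inE IH ?(ltnW jk) //= negbK.
have : p1 = iter (k2 - k1) (@ordS N) p2.
  move: e; rewrite -{1}(subnKC le12) iterD; move: (iter (k2 - k1) _ _) => r.
  by elim: (k1) => //= k IH /ordS_inj/IH.
case: (k2 - k1)%N (leq_subr k1 k2) => // j jk e1.
by move: hp1; rewrite e1 up.
Qed.

Lemma first_in_surj h A B q : height h A B -> q \in targets h A B ->
  exists2 p, p \in sources h A B & first_in (targets h A B) p = q.
Proof.
move=> hh qT.
suff : q \in first_in (targets h A B) @: sources h A B by case/imsetP => p pS ->; exists p.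
suff -> : first_in (targets h A B) @: sources h A B = targets h A B by [].
apply/eqP; rewrite eqEcard card_in_imset; last exact: first_in_inj.
rewrite card_sources // leqnn andbT; apply/fintype.subsetP => _ /imsetP[p pS ->].
exact: first_in_target.
Qed.

End Height.

(** * The update rule as a bijection *)

Section Update.
Variables n N : nat.
Hypothesis n_gt0 : (0 < n)%N.
Hypothesis nN : (n < N)%N.
Implicit Types (x y : config n N) (p q r : 'I_N) (h : 'I_N -> bool).

Let ordSN p : (ordS p == p) = false.
Proof. by apply/negbTE/ordS_neq/(leq_ltn_trans n_gt0). Qed.

Let ordS_eq p q : (ordS p == ordS q) = (p == q).
Proof. by rewrite (inj_eq (@ordS_inj N)). Qed.

Lemma moves_fun x p y y' : moves x p y -> moves x p y' -> y = y'.
Proof. by move=> /and3P[_ _ /eqP e] /and3P[_ _ /eqP e']; apply: val_inj; rewrite e e'. Qed.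

Lemma mem_moved x p y r : moves x p y ->
  (r \in val y) = (r == ordS p) || (r != p) && (r \in val x).
Proof. by move=> /and3P[_ _ /eqP ->]; rewrite !inE. Qed.

Lemma mem_moving x p y r : moves x p y ->
  (r \in val x) = (r == p) || (r != ordS p) && (r \in val y).
Proof.
move=> m; have /and3P[px Spx _] := m; rewrite (mem_moved _ m).
by case: (r =P p) => [->|_] //=; case: (r =P ordS p) => [->|] //=; apply: negbTE.
Qed.

Lemma moves_src_fun x x' p y : moves x p y -> moves x' p y -> x = x'.
Proof.
by move=> m m'; apply/val_inj/setP => r; rewrite (mem_moving _ m) (mem_moving _ m').
Qed.

Lemma moves_pos_fun x p q y : moves x p y -> moves x q y -> p = q.
Proof.
move=> m m'; have /and3P[px _ _] := m.
have : p \notin val y by rewrite (mem_moved _ m) eqxx orbF eq_sym ordSN.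
by rewrite (mem_moved _ m') px andbT; case: eqP => //= _ /negPn/eqP.
Qed.

(** The move shortens the arc that starts at [p] by its first step, so the height drops at [p] only.
    A site can be blocked only where the height has dropped. *)
Lemma moves_height x p x' y h : moves x p x' -> separates h (val x) (val y) ->
  height (fun r => h r && (r != p)) (val x') (val y)
  /\ p \in sources (fun r => h r && (r != p)) (val x') (val y).
Proof.
move=> m hs; have /and3P[px Spx _] := m.
have hp : h p by case: (hs p) => /(_ px).
split.
  split; first by exists p; rewrite eqxx andbF.
  move=> r; have [_ _] := hs r; rewrite (mem_moved _ m) ordS_eq.
  case: (r =P p) => [->|/eqP rp] /=.
    by rewrite ordSN (negbTE Spx) hp !andbT andbF addn0 /= => ->; rewrite addnC.
  case: (ordS r =P p) => [->|] //=; rewrite ?andbT // ?hp ?px ?andbF /= => e.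
  by move: e; rewrite addnC => /addIn ->; rewrite addn0.
rewrite inE eqxx andbF (mem_moved _ m) eqxx; apply/forallP => r; apply/implyP.
case/and4P=> _ yr; have [_ /(_ yr) ->] := hs r.
by rewrite negbK.
Qed.

(** Raising [h] at [p] gives a separating height for the retracted configuration; it also repairs
    the only site that could be blocked. *)
Lemma source_moves x' y h p : height h (val x') (val y) ->
  p \in sources h (val x') (val y) -> exists2 x, moves x p x' & interlaced x y.
Proof.
move=> hh; rewrite inE => /and3P[hp Spx' /forallP nb].
have {}nb r : r != p -> ~~ blocked h (val x') (val y) r.
  by apply: contra => br; apply: implyP (nb r) br.
have px' : p \notin val x'.
  have /(unblocked hh)[] : ~~ blocked h (val x') (val y) (ord_pred p).
    by apply: nb; rewrite -ordS_eq ord_predK eq_sym ordSN.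
  by rewrite ord_predK => /contraNN/(_ hp).
have cX : #|p |: (val x' :\ ordS p)|%SET == n.
  by have : #|val x'| == n := valP x'; rewrite (cardsD1 (ordS p) (val x')) Spx';
    rewrite cardsU1 !inE (negbTE px') andbF.
have [x m] : exists x, moves x p x'.
  exists (exist (fun z : {set 'I_N} => #|z| == n) _ cX).
  rewrite /moves /= !inE !eqxx ordSN /=; apply/eqP/setP => r; rewrite !inE.
  by case: (r =P ordS p) => [->|_] //=; case: (r =P p) => [->|] //=; apply: negbTE.
exists x => //; apply: (separates_interlaced n_gt0 (h := fun r => h r || (r == p))) => r.
have mx := mem_moving _ m.
case: (r =P p) => [->|/eqP rp].
  rewrite orbT !mx !eqxx ordSN /= orbF; split => //.
  have [_ /(_ p)] := hh; rewrite Spx' (negbTE hp).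
  by case: (h _); case: (_ \in _).
have [ux uy] := unblocked hh (nb _ rp); rewrite orbF; split=> //.
  rewrite mx (negbTE rp) /= => /andP[rSp rx].
  have /(unblocked hh)[] : ~~ blocked h (val x') (val y) (ord_pred r).
    by apply: nb; rewrite -ordS_eq ord_predK.
  by rewrite ord_predK => /(_ rx).
rewrite mx ordS_eq rp /=; have [_ /(_ r)] := hh.
case: (ordS r =P p) => [->|] /=; last by rewrite orbF.
by rewrite (negbTE hp) (negbTE px') add0n addn0 => ->; rewrite addn1.
Qed.

Lemma moves_target x' y y' h p : moves y (ordS p) y' -> separates h (val x') (val y') ->
  height (fun r => h r && (r != ordS p)) (val x') (val y)
  /\ p \in targets (fun r => h r && (r != ordS p)) (val x') (val y).
Proof.
move=> m hs; have /and3P[py Spy _] := m; have my := mem_moved _ m.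
have hp : h (ordS p) by case: (hs (ordS p)) => _ + _; apply; rewrite my eqxx.
split.
  split; first by exists (ordS p); rewrite eqxx andbF.
  move=> r; have [_ _] := hs r; rewrite my !ordS_eq.
  case: (r =P p) => [->|/eqP rp] /=.
    by rewrite py hp (eq_sym p) ordSN !andbT andbF /= addn0 => <-.
  case: (r =P ordS p) => [->|] //=; rewrite ?andbT // hp (negbTE Spy) ?andbF /= => e.
  by move: e; rewrite addn1 add1n => -[->]; rewrite addn0.
rewrite inE eqxx andbF py; apply/forallP => r; apply/implyP.
case/and4P=> xr _ _; have [/(_ xr) -> _ _] := hs (ordS r).
by rewrite negbK ordS_eq.
Qed.

Lemma target_moves x' y h p : height h (val x') (val y) ->
  p \in targets h (val x') (val y) ->
  exists2 y', moves y (ordS p) y' & interlaced x' y'.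
Proof.
move=> hh; rewrite inE => /and3P[hp py /forallP nb].
have {}nb r : r != p -> ~~ blocked h (val x') (val y) r.
  by apply: contra => br; apply: implyP (nb r) br.
have Spy : ordS (ordS p) \notin val y.
  have /(unblocked hh)[_] : ~~ blocked h (val x') (val y) (ordS p) by apply: nb; rewrite ordSN.
  by move=> /contraNN/(_ hp).
have cY : #|ordS (ordS p) |: (val y :\ ordS p)|%SET == n.
  by have : #|val y| == n := valP y; rewrite (cardsD1 (ordS p) (val y)) py;
    rewrite cardsU1 !inE (negbTE Spy) andbF.
have [y' m] : exists y', moves y (ordS p) y'.
  by exists (exist (fun z : {set 'I_N} => #|z| == n) _ cY); rewrite /moves py Spy eqxx.
exists y' => //; apply: (separates_interlaced n_gt0 (h := fun r => h r || (r == ordS p))) => r.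
have my := mem_moved _ m; rewrite my !ordS_eq.
split.
- case: (r =P ordS p) => [|/eqP rp] //; first by rewrite orbT.
  have /(unblocked hh)[] : ~~ blocked h (val x') (val y) (ord_pred r).
    by apply: nb; rewrite -ordS_eq ord_predK.
  by rewrite ord_predK => xr _ /xr ->.
- case: (r =P ordS p) => [|/eqP rp] //=; first by rewrite orbT.
  by case/andP=> rp' /(unblocked hh (nb _ rp')).2 ->.
- have [_ /(_ r)] := hh; case: (r =P p) => [->|/eqP rp].
    by rewrite py (negbTE hp) eq_sym ordSN /= orbF addn0 add0n => <-.
  case: (r =P ordS p) => [->|_] /=; last by rewrite !orbF.
  by rewrite (negbTE hp) (negbTE Spy) orbF addn0 => ->; rewrite addn1.
Qed.

(** By [height_unique], the height obtained from any admissible predecessor [x] is the given [h], so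
    one [h] detects them all. *)
Lemma sourcesP x' y h p : height h (val x') (val y) ->
  reflect (exists2 x, moves x p x' & interlaced x y) (p \in sources h (val x') (val y)).
Proof.
move=> hh; apply: (iffP idP) => [|[x m /(interlaced_separates n_gt0)[s sP]]].
  exact: source_moves.
have [h' pS] := moves_height m sP.
by rewrite (eq_sources _ _ (height_unique hh h')).
Qed.

Lemma targetsP x' y h p : height h (val x') (val y) ->
  reflect (exists2 y', moves y (ordS p) y' & interlaced x' y')
    (p \in targets h (val x') (val y)).
Proof.
move=> hh; apply: (iffP idP) => [|[y' m /(interlaced_separates n_gt0)[s sP]]].
  exact: target_moves.
have [h' pS] := moves_target m sP.
by rewrite (eq_targets _ _ (height_unique hh h')).
Qed.

Lemma update_first_in x x' y h p :
  moves x p x' -> interlaced x y -> height h (val x') (val y) ->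
  moves y (ordS (first_in (targets h (val x') (val y)) p)) (update x x' y)
  && interlaced x' (update x x' y).
Proof.
move=> m xy hh; set T := targets _ _ _; rewrite /update.
case: pickP => [q m'|/(_ p)]; last by rewrite m.
rewrite -(moves_pos_fun m m') {q m'}.
have pS : p \in sources h (val x') (val y) by apply/sourcesP => //; exists x.
have [k kN kT] := source_target hh pS.
have hs : has (mem T) (traject (@ordS N) p N).
  by apply/hasP; exists (iter k (@ordS N) p) => //; apply/trajectP; exists k.
have pushT r : isSome (push x' y (ordS r)) = (r \in T).
  rewrite /push; case: pickP => [z /andP[zm xz]|none] /=.
    by apply/esym/targetsP => //; exists z.
  by apply/esym/negbTE/negP => /(targetsP _ hh)[z zm xz]; have := none z; rewrite zm xz.
have pmE k' r : pmap (push x' y) (traject (@ordS N) (ordS r) k')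
    = pmap (push x' y \o @ordS N) (traject (@ordS N) r k').
  by elim: k' r => //= k' IH r; rewrite IH.
rewrite pmE; have := head_pmap (f := push x' y \o @ordS N) p y pushT hs.
rewrite /= -/(first_in T p) /push; case: pickP => // z zP [<-]; exact: zP.
Qed.

Lemma update_spec x x' y : interlaced x y -> arrow x x' ->
  arrow y (update x x' y) && interlaced x' (update x x' y).
Proof.
move=> xy /existsP[p m]; have [s sP] := interlaced_separates n_gt0 xy.
have [hh _] := moves_height m sP.
have /andP[mu ->] := update_first_in m xy hh.
by rewrite andbT; apply/existsP; eexists; exact: mu.
Qed.

(** The moving particle of [y] determines the source [p] by [first_in_inj], and [p] with [x']
    determines [x]. *)
Lemma update_inj x' y :
  {in [pred x | interlaced x y && arrow x x'] &, injective (fun x => update x x' y)}.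
Proof.
move=> x1 x2 /andP[xy1 /existsP[p1 m1]] /andP[xy2 /existsP[p2 m2]] e.
have [s sP] := interlaced_separates n_gt0 xy1.
have [hh p1S] := moves_height m1 sP.
have p2S := introT (sourcesP p2 hh) (ex_intro2 _ _ x2 m2 xy2).
have /andP[u1 _] := update_first_in m1 xy1 hh; have /andP[u2 _] := update_first_in m2 xy2 hh.
rewrite -e in u2.
have p12 := first_in_inj hh p1S p2S (ordS_inj (moves_pos_fun u1 u2)).
by rewrite p12 in m1; apply: moves_src_fun m1 m2.
Qed.

Lemma update_surj x' y y' : arrow y y' -> interlaced x' y' ->
  exists x, [/\ interlaced x y, arrow x x' & update x x' y = y'].
Proof.
move=> /existsP[q]; rewrite -(ord_predK q) => m xy'.
have [s sP] := interlaced_separates n_gt0 xy'.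
have [hh qT] := moves_target m sP.
have [p pS e] := first_in_surj hh qT.
have [x mx xy] := source_moves hh pS.
exists x; split=> //; first by apply/existsP; exists p.
by have /andP[] := update_first_in mx xy hh; rewrite e => m' _; apply: moves_fun m' m.
Qed.

End Update.

Local Open Scope classical_set_scope.
Local Open Scope ring_scope.

(** * Real-valued probabilities and finite partitions *)

Section FiniteValued.
Context {d : measure_display} {Omega : measurableType d} {R : realType}.
Variable P : probability Omega R.
Implicit Types A B : set Omega.

Definition pr A : R := fine (P A).

Lemma pr_fin A : measurable A -> P A = (pr A)%:E.
Proof. by move=> mA; rewrite /pr fineK // fin_num_measure. Qed.

Lemma pr_ge0 A : 0 <= pr A.
Proof. exact/fine_ge0/measure_ge0. Qed.

Lemma pr0 : pr set0 = 0.
Proof. by rewrite /pr measure0. Qed.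

Lemma le_pr A B : measurable A -> measurable B -> A `<=` B -> pr A <= pr B.
Proof.
move=> mA mB AB; rewrite fine_le ?fin_num_measure //.
by apply: le_measure; rewrite ?inE.
Qed.

Lemma measurable_preimage_finite (S : finType) (Z : Omega -> S) (B : set S) :
  (forall a, measurable (Z @^-1` [set a])) -> measurable (Z @^-1` B).
Proof.
move=> mZ; rewrite (_ : _ @^-1` _ = \bigcup_(a in B) (Z @^-1` [set a])).
  apply: fin_bigcup_measurable => //; exact: finite_finset.
by apply/seteqP; split=> [w Bw|w [a Ba /= ->]] //; exists (Z w).
Qed.

Lemma pr_partition (S : finType) (Z : Omega -> S) A :
  (forall a, measurable (Z @^-1` [set a])) -> measurable A ->
  pr A = \sum_a pr (A `&` Z @^-1` [set a]).
Proof.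
move=> mZ mA; have mAZ a : measurable (A `&` Z @^-1` [set a]) by exact: measurableI.
apply: EFin_inj; rewrite -pr_fin // -sumEFin.
rewrite -(eq_bigr _ (fun a _ => pr_fin (mAZ a))).
rewrite [in LHS](_ : A = \bigcup_(a in setT) (A `&` Z @^-1` [set a])).
  rewrite measure_fin_bigcup //; first last.
  - by move=> a b _ _ [w [[_ <-] [_ <-]]].
  - exact: finite_finset.
  rewrite (fsbigE (index_enum S)) ?index_enum_uniq //; last
    by move=> a _; rewrite mem_index_enum.
  by apply: eq_bigl => a; rewrite in_setT.
by apply/seteqP; split=> [w Aw|w [a _ []]] //; exists (Z w).
Qed.
End FiniteValued.

(** * The Markov property for events of the past *)

Section MarkovPath.
Context {d : measure_display} {Omega : measurableType d} {R : realType}.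
Variable P : probability Omega R.
Context {S : finType}.
Variables (X : nat -> Omega -> S) (mu : S -> R) (K : S -> S -> R).
Hypothesis mX : forall k a, measurable (X k @^-1` [set a]).

(** The past is packed into one finite-valued variable, to which [pr_partition] applies. *)
Definition path k w : {ffun 'I_k.+1 -> S} := [ffun i => X (val i) w].

Lemma path_fiber k (t : {ffun 'I_k.+1 -> S}) :
  path k @^-1` [set t] = history X k (fun i => t (inord i)).
Proof.
apply/seteqP; split=> w /=.
  by move=> e i ik; rewrite -e ffunE /= inordK.
by move=> h; apply/ffunP => i; rewrite ffunE h ?inord_val // -ltnS ltn_ord.
Qed.

Lemma measurable_history k s : measurable (history X k s).
Proof.
rewrite (_ : history X k s = \bigcap_(i in [set i | (i <= k)%N]) (X i @^-1` [set s i])) //.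
by apply: bigcap_measurable => [|i _ //]; exists 0%N.
Qed.

Lemma measurable_path k (E : set {ffun 'I_k.+1 -> S}) : measurable (path k @^-1` E).
Proof.
by apply: measurable_preimage_finite => t; rewrite path_fiber; exact: measurable_history.
Qed.

Hypothesis hX : markov_chain P mu K X.

(** The product form also covers histories of probability 0, where both sides vanish. *)
Lemma markov_history k s a :
  pr P (history X k s `&` X k.+1 @^-1` [set a]) = pr P (history X k s) * K (s k) a.
Proof.
have mH := measurable_history k s; have mHa := measurableI _ _ mH (mX k.+1 a).
have [P0|P0] := eqVneq (pr P (history X k s)) 0.
  apply/eqP; rewrite P0 mul0r eq_le pr_ge0 andbT -P0.
  by apply: le_pr => // w [].
have [_ _ /(_ k s a)] := hX; rewrite /cond_prob setIC => <-; first by rewrite mulrC divfK.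
by rewrite pr_fin // lte_fin lt_neqAle eq_sym P0 pr_ge0.
Qed.

Lemma markov_path k (E : set {ffun 'I_k.+1 -> S}) x a :
  (forall t, E t -> t ord_max = x) ->
  pr P (path k @^-1` E `&` X k.+1 @^-1` [set a]) = pr P (path k @^-1` E) * K x a.
Proof.
move=> Ex; have mp t : measurable (path k @^-1` [set t]) by exact: measurable_path.
rewrite (pr_partition P mp); last by apply: measurableI; [exact: measurable_path|].
rewrite [in RHS](pr_partition P mp); last exact: measurable_path.
rewrite mulr_suml; apply: eq_bigr => t _.
have pE : path k @^-1` E `&` path k @^-1` [set t]
    = if `[< E t >] then history X k (fun i => t (inord i)) else set0.
  case: asboolP => Et; rewrite -?path_fiber; apply/seteqP; split=> w //=.
  - by case.
  - by move=> e; split; rewrite ?e.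
  - by case=> + e; rewrite e.
rewrite setIAC pE; case: asboolP => Et; last by rewrite set0I pr0 mul0r.
rewrite markov_history -(Ex t Et); congr (_ * K (t _) a).
by apply: val_inj; rewrite /= inordK.
Qed.
End MarkovPath.

(** * From an intertwined coupling to a Markov chain *)

Section Intertwining.
Context {d : measure_display} {Omega : measurableType d} {R : realType}.
Variable P : probability Omega R.
Context {S T : finType}.
Variables (X : nat -> Omega -> S) (Y : nat -> Omega -> T) (f : S -> S -> T -> T).
Variables (y : T) (K : S -> S -> R) (L : T -> T -> R) (M : T -> S -> R).
Hypothesis hX : markov_chain P (M y) K X.
Hypothesis Y0 : forall w, Y 0%N w = y.
Hypothesis YS : forall k w, Y k.+1 w = f (X k w) (X k.+1 w) (Y k w).
Hypothesis M1 : forall z, \sum_x M z x = 1.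
Hypothesis intertwined : forall z z' x',
  \sum_(x | f x x' z == z') M z x * K x x' = L z z' * M z' x'.

Fixpoint run (x : nat -> S) k :=
  if k is k'.+1 then f (x k') (x k) (run x k') else y.

Lemma run_path k i w : (i <= k)%N -> Y i w = run (fun j => path X k w (inord j)) i.
Proof.
elim: i => [|i IH] ik; first exact: Y0.
by rewrite YS IH ?(ltnW ik) //= !ffunE /= !inordK ?ltnS // ltnW.
Qed.

Let mX k a : measurable (X k @^-1` [set a]).
Proof. by case: hX. Qed.

Lemma measurable_driven k a : measurable (Y k @^-1` [set a]).
Proof.
rewrite (_ : _ @^-1` _ = path X k @^-1` [set t | run (fun j => t (inord j)) k = a]).
  exact: measurable_path.
by apply/seteqP; split=> w /=; rewrite (run_path w (leqnn k)).
Qed.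

Let mH k s : measurable (history Y k s).
Proof. exact: measurable_history measurable_driven k s. Qed.

Let mHX k s x : measurable (history Y k s `&` X k @^-1` [set x]).
Proof. exact: measurableI. Qed.

(** The history of [Y] is a function of the path of [X] by [run_path], so this is an event of the
    past of [X] with current state [x]. *)
Lemma joint_markov k s x a :
  pr P (history Y k s `&` X k @^-1` [set x] `&` X k.+1 @^-1` [set a])
  = pr P (history Y k s `&` X k @^-1` [set x]) * K x a.
Proof.
pose E := [set t : {ffun 'I_k.+1 -> S} |
  (forall i, (i <= k)%N -> run (fun j => t (inord j)) i = s i) /\ t ord_max = x].
have -> : history Y k s `&` X k @^-1` [set x] = path X k @^-1` E.
  apply/seteqP; split=> w /= [h Xx]; (split; last by move: Xx; rewrite ffunE).
    by move=> i ik; rewrite -run_path // h.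
  by move=> i ik; rewrite (run_path w ik) h.
by apply: (markov_path mX hX) => t [].
Qed.

(** Once [X k], [X k.+1] and [Y k] are fixed, [Y k.+1] is determined; summing over [X k] produces
    the left side of [intertwined]. *)
Lemma joint_step k s x' :
  (forall x, pr P (history Y k s `&` X k @^-1` [set x]) = pr P (history Y k s) * M (s k) x) ->
  pr P (history Y k.+1 s `&` X k.+1 @^-1` [set x'])
  = pr P (history Y k s) * L (s k) (s k.+1) * M (s k.+1) x'.
Proof.
move=> h; rewrite (pr_partition P (mX k)) //.
rewrite -mulrA -intertwined mulr_sumr [RHS]big_mkcond /=; apply: eq_bigr => x _.
have -> : history Y k.+1 s `&` X k.+1 @^-1` [set x'] `&` X k @^-1` [set x]
    = if f x x' (s k) == s k.+1
      then history Y k s `&` X k @^-1` [set x] `&` X k.+1 @^-1` [set x'] else set0.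
  case: eqP => e; apply/seteqP; split=> w //=.
  - by move=> [[H e1] e2]; split=> //; split=> // i ik; apply: H; rewrite ltnW.
  - move=> [[H e1] e2]; split=> //; split=> // i.
    rewrite leq_eqVlt => /predU1P[->|/H //].
    by rewrite YS e1 e2 H.
  - by move=> [[H e1] e2]; apply: e; rewrite -e1 -e2 -(H k) // -YS H.
case: eqP => _; last exact: pr0.
by rewrite joint_markov h mulrA.
Qed.

Lemma joint_law k s x :
  pr P (history Y k s `&` X k @^-1` [set x]) = pr P (history Y k s) * M (s k) x.
Proof.
elim: k x => [|k IH] x.
  have [_ /(_ x) X0 _] := hX.
  have [sy|sy] := eqVneq (s 0%N) y.
    have -> : history Y 0 s = setT.
      by apply/seteqP; split=> w // _ i; rewrite leqn0 => /eqP ->; rewrite Y0.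
    by rewrite setTI [pr P setT]/pr probability_setT mul1r sy -X0.
  have -> : history Y 0 s = set0.
    by apply/seteqP; split=> w // /(_ 0%N isT) e; move: sy; rewrite -e Y0 eqxx.
  by rewrite set0I pr0 mul0r.
rewrite joint_step // [in RHS](pr_partition P (mX k.+1)) //.
rewrite [X in _ = X * _](eq_bigr _ (fun x' _ => joint_step x' IH)).
by rewrite -mulr_sumr M1 mulr1.
Qed.

Lemma history_step k s :
  pr P (history Y k.+1 s) = pr P (history Y k s) * L (s k) (s k.+1).
Proof.
rewrite (pr_partition P (mX k.+1)) //.
rewrite (eq_bigr _ (fun x' _ => joint_step x' (joint_law k s))).
by rewrite -mulr_sumr M1 mulr1.
Qed.

Lemma intertwining_markov : markov_chain P (fun z => (z == y)%:R) L Y.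
Proof.
split; first exact: measurable_driven.
  move=> a; have [->|ay] := eqVneq a y.
    rewrite (_ : _ @^-1` _ = setT) ?probability_setT //.
    by apply/seteqP; split=> w //= _; rewrite Y0.
  rewrite (_ : _ @^-1` _ = set0) ?measure0 //.
  by apply/seteqP; split=> w //= e; move: ay; rewrite -e Y0 eqxx.
move=> k s a P0; rewrite /cond_prob -!/(pr P _).
(* [history_step] takes the next state from the sequence itself, so [a] is appended to [s]. *)
pose s' i := if (i <= k)%N then s i else a.
have sE : history Y k s = history Y k s'.
  by apply/seteqP; split=> w h i ik; rewrite h // /s' ik.
have -> : Y k.+1 @^-1` [set a] `&` history Y k s = history Y k.+1 s'.
  rewrite sE; apply/seteqP; split=> w.
    move=> [Ya h] i; rewrite leq_eqVlt => /predU1P[->|/h //].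
    by rewrite /s' ltnn.
  move=> h; split=> [|i ik]; last by apply: h; rewrite ltnW.
  by rewrite /= h // /s' ltnn.
rewrite history_step -sE /s' leqnn ltnn mulrAC divff ?mul1r //.
by move: P0; rewrite pr_fin // lte_fin => /gt_eqF ->.
Qed.

Lemma intertwining_cond k s x : (0 < P (history Y k s))%E ->
  cond_prob P (X k @^-1` [set x]) (history Y k s) = M (s k) x.
Proof.
move=> P0; rewrite /cond_prob -!/(pr P _) setIC joint_law mulrC mulKf //.
by move: P0; rewrite pr_fin // lte_fin => /gt_eqF ->.
Qed.

(** At each time, [joint_law] gives probability 0 to every pair where [M] vanishes; the exceptional
    set is a countable union over [k]. *)
Lemma intertwining_support : {ae P, forall w, forall k, M (Y k w) (X k w) != 0}.
Proof.
pose D k := [set w | M (Y k w) (X k w) = 0].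
suff : P.-negligible (\bigcup_k D k).
  apply: negligibleS.
  by move=> w /= /existsNP[k /negP/negPn/eqP e]; exists k.
apply: negligible_bigcup => k.
have mD : measurable (D k).
  rewrite (_ : D k = \bigcup_x (X k @^-1` [set x] `&` Y k @^-1` [set z | M z x = 0])).
    apply: fin_bigcup_measurable => [|x _]; first exact: finite_finset.
    apply: measurableI => //; apply: measurable_preimage_finite; exact: measurable_driven.
  apply/seteqP; split=> w /=; first by exists (X k w).
  by case=> x _ /= [<-].
apply/negligibleP => //; apply: (etrans (pr_fin P mD)); congr EFin.
have mYp t : measurable (path Y k @^-1` [set t])
  by apply: measurable_path; exact: measurable_driven.
rewrite (pr_partition P mYp) // big1 // => t _.
rewrite (pr_partition P (mX k)); last exact: measurableI.
apply: big1 => x _; rewrite path_fiber.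
set s := fun i => _; have [M0|M0] := eqVneq (M (s k) x) 0.
  apply/eqP; rewrite eq_le pr_ge0 andbT -(mulr0 (pr P (history Y k s))) -M0 -joint_law.
  apply: le_pr => //; last by move=> w [[]].
  by apply: measurableI => //; apply: measurableI.
rewrite (_ : _ `&` _ = set0) ?pr0 //; apply/seteqP; split=> w //= [[Dw h] e].
by move/eqP: M0; apply; rewrite -(h k) // -e.
Qed.

End Intertwining.

(** * Nonvanishing of Δ *)

Section Delta.
Variables (R : realType) (n N : nat).

Lemma circle_point_inj (i j : 'I_N) : (i < j)%N ->
  circle_point j != circle_point i :> R[i].
Proof.
move=> ij; apply/eqP => -[].
set t := 2 * pi * j%:R / N%:R; set s := 2 * pi * i%:R / N%:R => ct st.
have N0 : (0 : R) < N%:R by rewrite ltr0n (leq_ltn_trans (leq0n i)).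
(* Half the angle between the points is π(j-i)/N, strictly between 0 and π, so its sine is positive;
   equal points would give cos(2u) = 1. *)
pose u : R := (t - s) / 2.
have uE : u = pi * ((j%:R - i%:R) / N%:R) by rewrite /u /t /s; field; rewrite gt_eqF.
have u0 : 0 < sin u.
  apply: sin_gt0_pi; rewrite uE mulr_gt0 ?pi_gt0 //=; last first.
    by rewrite divr_gt0 // subr_gt0 ltr_nat.
  rewrite -[ltRHS]mulr1 ltr_pM2l ?pi_gt0 // ltr_pdivrMr // mul1r.
  by rewrite (le_lt_trans (y := j%:R)) ?gerBl ?ltr_nat.
have : cos (t - s) = 1 by rewrite cosB ct st -!expr2 cos2Dsin2.
rewrite (_ : t - s = u *+ 2); last by rewrite /u mulr2n -splitr.
rewrite cos_mulr2n; have := cos2Dsin2 u; nra.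
Qed.

Lemma Delta_neq0 (x : config n N) : Delta x != 0 :> R.
Proof.
apply/prodf_neq0 => i _; apply/prodf_neq0 => j /andP[_ ij].
apply/eqP => /ComplexField.Normc.eq0_normc/eqP.
by rewrite subr_eq0; apply/negP/circle_point_inj.
Qed.

End Delta.

(** * The intertwining of [Q] and [M] *)

Section Kernels.
Variables (R : realType) (n N : nat).
Hypothesis n_gt0 : (0 < n)%N.
Hypothesis nN : (n < N)%N.
Implicit Types x y z : config n N.

(** The default value of [gamma] is 0, so a nonzero [gamma] satisfies its specification. *)
Lemma sum_M : gamma n N != 0 :> R -> forall y, \sum_x M y x = 1 :> R.
Proof.
move=> g0 y; have [g gP] : exists g : R, gamma_spec n N g.
  apply: contrapT => none; move/eqP: g0; apply; rewrite /gamma xgetPN // => g gP.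
  by apply: none; exists g.
have [_ /(_ y) gy] : gamma_spec n N (gamma n N : R) by apply: xgetPex; exists g.
transitivity (\sum_(x | interlaced x y) (gamma n N)^-1 / Delta y * Delta x : R).
  rewrite [RHS]big_mkcond; apply: eq_bigr => x _.
  by rewrite /M; case: interlaced; rewrite ?mulr0 // mulr1 mulrA mulrAC.
by rewrite -mulr_sumr gy; field; rewrite g0 Delta_neq0.
Qed.

Lemma M_Q y x x' : M y x * Q x x' = (gamma n N * lambda n N)^-1 * (Delta x' / Delta y)
  * (interlaced x y && arrow x x')%:R :> R.
Proof.
rewrite /M /Q; case: interlaced; case: arrow; rewrite ?mulr0 ?mul0r ?mulr1 //=.
(* With the inverses abstracted, [field] asks only for the nonvanishing of Δ. *)
by rewrite invfM; move: (gamma n N)^-1 (lambda n N)^-1 => a b; field; rewrite !Delta_neq0.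
Qed.

Lemma Q_M y y' x' : Q y y' * M y' x' = (gamma n N * lambda n N)^-1 * (Delta x' / Delta y)
  * (arrow y y' && interlaced x' y')%:R :> R.
Proof.
rewrite /M /Q; case: arrow; case: interlaced; rewrite ?mulr0 ?mul0r ?mulr1 //=.
by rewrite invfM; move: (gamma n N)^-1 (lambda n N)^-1 => a b; field; rewrite !Delta_neq0.
Qed.

(** By the bijection, the sum has exactly one nonzero indicator when [y'] is admissible, and none
    otherwise. *)
Lemma M_Q_update y y' x' :
  \sum_(x | update x x' y == y') M y x * Q x x' = Q y y' * M y' x' :> R.
Proof.
rewrite Q_M; under eq_bigr do rewrite M_Q.
case: (boolP (arrow y y' && interlaced x' y')) => [/andP[yy' xy']|nyy'].
  have [x [xy xx' ux]] := update_surj n_gt0 nN yy' xy'.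
  rewrite (bigD1 x) ?ux //= xy xx' big1 ?addr0 // => x1 /andP[/eqP u1 nx1].
  case: (boolP (_ && _)) => [h1|_]; last by rewrite mulr0.
  case/eqP: nx1; apply: (update_inj n_gt0 nN (x' := x') (y := y)) => //.
    by rewrite inE xy.
  by rewrite u1.
rewrite mulr0 big1 // => x /eqP ux.
case: (boolP (_ && _)) => [/andP[xy xx']|_]; last by rewrite mulr0.
by move: nyy'; rewrite -ux (update_spec n_gt0 nN xy xx').
Qed.

End Kernels.

Theorem proposition1p2 (R : realType) (n N : nat) (hn : (1 <= n)%N)
    (hnN : (n < N)%N) (y : config n N)
    (d : measure_display) (Omega : measurableType d)
    (P : probability Omega R) (X : nat -> Omega -> config n N)
    (hX : markov_chain P (M y) Q X) :
  [/\ {ae P, forall w, forall k, interlaced (X k w) (driven y X k w)},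
      markov_chain P (fun z => (z == y)%:R) Q (driven y X)
    & forall T : nat, (0 < T)%N ->
      forall s : nat -> config n N, (0 < P (history (driven y X) T s))%E ->
      forall x : config n N,
        cond_prob P (X T @^-1` [set x]) (history (driven y X) T s)
        = M (s T) x].
Proof.
have g0 : gamma n N != 0 :> R.
  have [mX X0 _] := hX; apply/eqP => g0.
  have := pr_partition P (mX 0%N) measurableT.
  rewrite /pr probability_setT big1 => [/eqP|x _]; first by rewrite oner_eq0.
  by rewrite setTI X0 /M g0 invr0 !mul0r.
have M1 := sum_M g0; have MQ := M_Q_update R hn hnN.
have Y0 w : driven y X 0 w = y by [].
have YS k w : driven y X k.+1 w = update (X k w) (X k.+1 w) (driven y X k w) by [].
split.
- have := intertwining_support (f := fun x x' z => update x x' z) hX Y0 YS M1 MQ.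
  apply: filterS => w Mw k; have := Mw k.
  by rewrite /M; case: interlaced; rewrite ?mulr0 ?eqxx.
- exact: (intertwining_markov (f := fun x x' z => update x x' z) hX Y0 YS M1 MQ).
- move=> T _ s P0 x.
  exact: (intertwining_cond (f := fun x x' z => update x x' z) hX Y0 YS M1 MQ).
Qed.
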